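(* Let $(X,d)$ be a compact metric space, let $\phi$ be a regular continuous flow on $X$ and let $x_1\in X$. If $\phi$ is expansive on $X\setminus\mathrm{orb}(x_1)$, then $\phi$ is expansive on $X$.
   Context: A continuous flow on $X$ is a continuous map $\phi\colon\mathbb{R}\times X\to X$, $\phi_t=\phi(t,\cdot)$, with $\phi_0=\mathrm{id}$ and $\phi_{t+s}=\phi_s\circ\phi_t$; it is regular if it has no fixed points. $\mathrm{orb}(x)=\{\phi_t(x):t\in\mathbb{R}\}$. Let $Rep$ be the set of increasing homeomorphisms $h\colon\mathbb{R}\to\mathbb{R}$ with $h(0)=0$. For a subset $Y\subset X$, $\phi$ is expansive on $Y$ if for every $\varepsilon>0$ there is $\delta>0$ such that whenever $x,y\in Y$ and $h\in Rep$ satisfy $d(\phi_t(x),\phi_{h(t)}(y))\le\delta$ for all $t\in\mathbb{R}$, then $y\in\phi_{[-\varepsilon,\varepsilon]}(x)$. Expansive on $X$ is this condition with $Y=X$. *)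

(* Defs.v *)
From HB Require Import structures.
From mathcomp Require Import all_boot all_order all_algebra.
From mathcomp Require Import all_classical all_reals all_analysis.
Set Implicit Arguments. Unset Strict Implicit. Unset Printing Implicit Defensive.
Import Order.TTheory GRing.Theory Num.Theory.
Import numFieldNormedType.Exports.
Local Open Scope classical_set_scope.
Local Open Scope ring_scope.

Definition is_flow {R : realType} {X : topologicalType} (phi : R -> X -> X) :=
  continuous (fun p : R * X => phi p.1 p.2) /\
  (forall x, phi 0 x = x) /\
  (forall t s x, phi (t + s) x = phi s (phi t x)).

Definition regular_flow {R : realType} {X : topologicalType} (phi : R -> X -> X) :=
  forall x, ~ (forall t, phi t x = x).

Definition orb {R : realType} {X : Type} (phi : R -> X -> X) (x : X) : set X :=
  [set phi t x | t in [set: R]].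

(* Rep: increasing homeomorphisms h of R with h 0 = 0 *)
Definition Rep {R : realType} (h : R -> R) :=
  {homo h : s t / s < t} /\ continuous h /\
  (forall y, exists t, h t = y) /\ h 0 = 0.

Definition expansive_on {R : realType} {X : metricType R}
    (phi : R -> X -> X) (Y : set X) :=
  forall eps : R, 0 < eps -> exists2 delta : R, 0 < delta &
    forall x y h, Y x -> Y y -> Rep h ->
      (forall t, mdist (phi t x) (phi (h t) y) <= delta) ->
      exists2 s, `|s| <= eps & y = phi s x.

(* Main.v *)
(* Suppose y outside orb x1 tracks x1 within delta (up to a time change).  Two
   such points track each other, so by expansivity off the orbit they lie on a
   common orbit segment of length 2; points tracking x1 arbitrarily closely
   accumulate at x1, which would put x1 on the orbit of y.  Hence, for small
   delta, every point tracking x1 lies on orb x1, and it remains to bound the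
   time shift g(t) - t when phi_{g(t)} x1 tracks phi_t x1.

   If x1 is periodic this is compactness of the orbit.  Otherwise, without fixed
   points, phi_eta z stays uniformly away from z for small eta, so g(t) - t never
   takes the values +-eta, and the shift is small for all t as soon as it is
   small at one time.  The remaining possibility is that arbitrarily good
   self-trackings g have arbitrarily large g(s).  Composing infinitely many of
   them, each chosen extremely good with respect to the previous ones, gives
   points phi_{g_n(0)} x1 converging to a point w that avoids every segment
   phi_[-n,n] x1 but still tracks x1, contradicting the first step. *)
Require Import Defs.
From HB Require Import structures.
From mathcomp Require Import all_boot all_order all_algebra.
From mathcomp Require Import all_classical all_reals all_analysis.
From mathcomp Require Import ring lra.
Import Order.TTheory GRing.Theory Num.Theory.
Import numFieldNormedType.Exports.
Local Open Scope classical_set_scope.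
Local Open Scope ring_scope.
Set Implicit Arguments.
Unset Strict Implicit.

(** * Uniformity from compactness, and homeomorphisms of the line *)

Lemma mdist_cvg (R : realType) (X : metricType R) (T : Type) (F : set_system T)
    (FF : Filter F) (f g : T -> X) (a b : X) :
  f x @[x --> F] --> a -> g x @[x --> F] --> b ->
  mdist (f x) (g x) @[x --> F] --> mdist a b.
Proof.
move=> fa gb; apply/cvgrPdist_le => e e0.
have e20 : 0 < e / 2 by rewrite divr_gt0.
near=> x.
have Ha : mdist a (f x) <= e / 2.
  by near: x; exact: (metricType_numDomainType.cvgr_dist_le fa).
have Hb : mdist b (g x) <= e / 2.
  by near: x; exact: (metricType_numDomainType.cvgr_dist_le gb).
have := metric_triangle a (f x) b; have := metric_triangle (f x) (g x) b.
have := metric_triangle (f x) a (g x); have := metric_triangle a b (g x).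
rewrite (metric_sym (g x) b) (metric_sym (f x) a) => ? ? ? ?.
rewrite ler_norml; lra.
Unshelve. all: by end_near. Qed.

(** The joint filter lets one e serve all neighbourhoods of a finite cover, however [P] depends on
    e. *)
Lemma near_unif_compact (R : realType) (T : topologicalType) (K : set T)
    (P : R -> T -> Prop) :
  compact K -> (forall x, K x -> \forall y \near x & e \near 0^'+, P e y) ->
  exists2 e : R, 0 < e & forall x, K x -> P e x.
Proof.
move=> /compact_near_coveringP cK KP.
have H := cK _ _ P _ KP.
near (0:R)^'+ => e; exists e; first by near: e; exact: nbhs_right_gt.
by near: e; exact: H.
Unshelve. all: by end_near. Qed.

Lemma compact_pos_lbound (R : realType) (T : topologicalType) (K : set T)
    (f : T -> R) :
  compact K -> continuous f -> (forall x, K x -> 0 < f x) ->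
  exists2 e : R, 0 < e & forall x, K x -> e < f x.
Proof.
move=> cK cf f0; apply: (@near_unif_compact _ _ _ (fun e x => e < f x)) => //.
move=> x Kx; have fx := f0 _ Kx.
near=> y e => /=.
apply: (@lt_trans _ _ (f x / 2)).
  by near: e; apply: nbhs_right_lt; rewrite divr_gt0.
near: y; apply: (cvgr_gt (f x)); first exact: cf.
by rewrite ltr_pdivrMr // ltr_pMr // ltr1n.
Unshelve. all: by end_near. Qed.

Lemma increasing_surj_continuous (R : realType) (f : R -> R) :
  {homo f : s t / s < t} -> (forall y, exists t, f t = y) -> continuous f.
Proof.
move=> /ltW_homo fm fs t; apply/cvgrPdist_le => e e0.
have [a fa] := fs (f t - e); have [b fb] := fs (f t + e).
have ta : a < t by rewrite ltNge; apply/negP => /fm; lra.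
have tb : t < b by rewrite ltNge; apply/negP => /fm; lra.
near=> s.
have /fm sa : a <= s by near: s; exact: (cvgr_ge t cvg_id).
have /fm sb : s <= b by near: s; exact: (cvgr_le t cvg_id).
by rewrite ler_norml; lra.
Unshelve. all: by end_near. Qed.

Lemma increasing_surj_inv (R : realType) (f : R -> R) :
  {homo f : s t / s < t} -> (forall y, exists t, f t = y) ->
  exists k, [/\ {homo k : s t / s < t}, continuous k, cancel f k & cancel k f].
Proof.
move=> fm fs; have [k fk] := choice fs.
have fi : injective f.
  by move=> s t fst; case: (ltgtP s t) => // /fm; rewrite fst ltxx.
have kf : cancel f k by move=> t; apply: fi; rewrite fk.
have km : {homo k : s t / s < t}.
  by move=> s t st; rewrite ltNge; apply/negP => /(ltW_homo fm);
    rewrite !fk leNgt st.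
exists k; split=> //; apply: increasing_surj_continuous => // y.
by exists (f y).
Qed.

Lemma Rep_inv (R : realType) (h : R -> R) : Rep h ->
  exists k, Rep k /\ cancel k h.
Proof.
move=> [hm [_ [hs h0]]]; have [k [km ck hk kh]] := increasing_surj_inv hm hs.
exists k; split => //; split => //; split => //; split.
  by move=> y; exists (h y).
by rewrite -h0 hk.
Qed.

Lemma Rep_comp (R : realType) (h k : R -> R) : Rep h -> Rep k -> Rep (k \o h).
Proof.
move=> [hm [hc [hs h0]]] [km [kc [ks k0]]]; split; first by move=> s t /hm /km.
split; first by move=> t; apply: continuous_comp; [exact: hc|exact: kc].
split; last by rewrite /= h0.
by move=> y; have [u <-] := ks y; have [t <-] := hs u; exists t.
Qed.


(** The order of a and b is left open; the bound on [|c - a|] keeps c inside the time window of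
    [tracking_near_id]. *)
Lemma IVT_between (R : realType) (f : R -> R) (a b v : R) :
  continuous f -> f a <= v <= f b ->
  exists2 c, `|c - a| <= `|b - a| & f c = v.
Proof.
move=> cf /andP[av vb].
have [ab|/ltW ba] := leP a b.
- have [] := @IVT R f a b v ab (continuous_subspaceT cf).
    by rewrite ge_min av /= le_max vb orbT.
  move=> c; rewrite in_itv /= => /andP[ac cb] fc; exists c => //.
  by rewrite !ger0_norm ?subr_ge0 // lerB.
- have [] := @IVT R f b a v ba (continuous_subspaceT cf).
    by rewrite ge_min av orbT /= le_max vb.
  move=> c; rewrite in_itv /= => /andP[bc ca] fc; exists c => //.
  by rewrite !ler0_norm ?subr_le0 // lerN2 lerB.
Qed.

(** [Rep] without the normalisation at 0: self-trackings may move time 0, and where they send it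
    decides escape. *)
Definition increasing_homeo {R : realType} (g : R -> R) :=
  [/\ {homo g : s t / s < t}, continuous g & forall y, exists t, g t = y].

(** The scenario to be refuted: the bound required by [self_tracking_bounded] fails for all d, M and
    s at once. *)
Definition self_tracking_escapes {R : realType} {X : metricType R}
    (phi : R -> X -> X) (x : X) := forall d M s, 0 < d ->
  exists g, [/\ increasing_homeo g,
    forall t, mdist (phi t x) (phi (g t) x) <= d & M < `|g s|].

(** * Small times and periods of a flow *)

Section flow.
Context {R : realType} {X : metricType R} {phi : R -> X -> X}.
Hypothesis flow : is_flow phi.

Let flow0 x : phi 0 x = x. Proof. by have [_ []] := flow. Qed.

Let flowD t s x : phi (t + s) x = phi s (phi t x).
Proof. by have [_ []] := flow. Qed.

Lemma flow_cvg {T : Type} {F : set_system T} {FF : Filter F} {f : T -> R}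
    {g : T -> X} {a x} :
  f u @[u --> F] --> a -> g u @[u --> F] --> x ->
  phi (f u) (g u) @[u --> F] --> phi a x.
Proof.
have [cphi _] := flow.
apply: (@continuous2_cvg _ R X X F _ f g phi a x).
exact: (cphi (a, x)).
Qed.

Lemma flow_small_time e : compact [set: X] -> 0 < e ->
  exists2 th, 0 < th & forall r x, `|r| <= th -> mdist (phi r x) x <= e.
Proof.
move=> cX e0.
case: (@near_unif_compact R X setT
  (fun th x => forall r, `|r| <= th -> mdist (phi r x) x <= e) cX); last first.
  by move=> th th0 H; exists th => // r x; apply: H.
move=> x _.
have : nbhs (0 : R, x) [set p | mdist (phi p.1 p.2) p.2 < e].
  apply: (@cvgr_lt R (R * X)%type (nbhs (0 : R, x)) _
    (fun p => mdist (phi p.1 p.2) p.2) (mdist (phi 0 x) x)).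
    apply: mdist_cvg; last exact: cvg_snd.
    by apply: flow_cvg; [exact: cvg_fst|exact: cvg_snd].
  by rewrite flow0 mdistxx.
move=> [[A B] /= [A0 Bx] AB].
move/nbhs_ballP: A0 => [d /= d0 dA].
near=> y th => /= r rth; apply: ltW; apply: (AB (r, y)); split => /=.
  apply: dA; rewrite /ball/= sub0r normrN (le_lt_trans rth)//.
by near: y.
Unshelve. all: by end_near. Qed.

Lemma flow_periodZ T x (k : int) : phi T x = x -> phi (k%:~R * T) x = x.
Proof.
move=> Tx; have per n : phi (n%:R * T) x = x.
  elim: n => [|n IH]; first by rewrite mul0r flow0.
  by rewrite -natr1 mulrDl mul1r flowD IH.
case: k => n; first exact: per.
by rewrite NegzE mulrNz mulNr -[in LHS](per n.+1) -flowD subrr flow0.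
Qed.

(* If phi_r x = x with r tiny, then x almost returns at every time t: t is
   within r of a multiple of r.  By regularity this fails near every point. *)
Lemma flow_no_short_period : compact [set: X] -> regular_flow phi ->
  exists2 tau, 0 < tau & forall r x, 0 < r <= tau -> phi r x <> x.
Proof.
move=> cX reg.
case: (@near_unif_compact R X setT
  (fun tau x => forall r, 0 < r <= tau -> phi r x <> x) cX); last first.
  by move=> tau tau0 H; exists tau => // r x; apply: H.
move=> x _.
have /existsNP[t tx] := reg x.
have d0 : 0 < mdist (phi t x) x by rewrite mdist_gt0; exact/eqP.
have : nbhs (t, x) [set p | 0 < mdist (phi p.1 p.2) p.2].
  apply: (@cvgr_gt R (R * X)%type (nbhs (t, x)) _
    (fun p => mdist (phi p.1 p.2) p.2) (mdist (phi t x) x)) => //.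
  apply: mdist_cvg; last exact: cvg_snd.
  by apply: flow_cvg; [exact: cvg_fst|exact: cvg_snd].
move=> [[A B] /= [A0 Bx] AB].
move/nbhs_ballP: A0 => [d /= d0' dA].
near=> y th => /= r /andP[r0 rth] yr.
have : 0 < mdist (phi ((Num.floor (t / r))%:~R * r) y) y.
  apply: (AB (_, y)); split => /=; last by near: y.
  apply: dA; rewrite /ball/=.
  have rd : r < d.
    by rewrite (le_lt_trans rth).
  rewrite ger0_norm ?subr_ge0 -?ler_pdivlMr ?floor_le//; last first.
  apply: lt_trans rd.
  by rewrite ltrBlDl; have := Num.Theory.floorD1_gt (t / r);
    rewrite intrD ltr_pdivrMr // mulrDl mul1r.
by rewrite flow_periodZ // mdistxx ltxx.
Unshelve. all: by end_near. Qed.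

(** * Time shifts of tracking orbits *)

Lemma flow_sep_norm eta rho s t x : (forall z, rho < mdist z (phi eta z)) ->
  `|s - t| = eta -> rho < mdist (phi s x) (phi t x).
Proof.
move=> sep; have [_|_] := ger0P (s - t) => st.
  have -> : s = t + eta by lra.
  by rewrite flowD metric_sym.
have -> : t = s + eta by lra.
by rewrite flowD.
Qed.

(** If [|h u - u|] exceeded eta, it would equal eta at some c with [|c| <= |u|]. There phi_(h c) x
    and phi_c x are more than rho apart, yet both are close to phi_(h c) y: the first because y is
    near x (tracking at t = 0) and h c stays in a bounded window, the second by tracking. *)
Lemma tracking_near_id (eta rho M : R) (x : X) :
  0 <= eta -> 0 < rho ->
  (forall z, rho < mdist z (phi eta z)) ->
  exists2 delta, 0 < delta & forall y h, continuous h -> h 0 = 0 ->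
    (forall t, mdist (phi t x) (phi (h t) y) <= delta) ->
    forall u, `|u| <= M -> `|h u - u| <= eta.
Proof.
move=> eta0 rho0 sep.
have rho20 : 0 < rho / 2 by rewrite divr_gt0.
set K := `[- (M + eta), M + eta]%classic : set R.
have : \forall y \near x, forall q, K q -> mdist (phi q x) (phi q y) < rho / 2.
  have /compact_near_coveringP cK := @segment_compact R (- (M + eta)) (M + eta).
  apply: (cK X (nbhs x) (fun y q => mdist (phi q x) (phi q y) < rho / 2)).
  move=> q _.
  apply: (@cvgr_lt R (R * X)%type (nbhs (q, x)) _
    (fun p => mdist (phi p.1 x) (phi p.1 p.2)) (mdist (phi q x) (phi q x))).
    apply: mdist_cvg; apply: flow_cvg;
      [exact: cvg_fst|exact: cvg_cst|exact: cvg_fst|exact: cvg_snd].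
  by rewrite mdistxx.
move=> /nbhs_ballP[d /= d0 dK].
exists (Num.min (rho / 2) (d / 2)).
  by rewrite lt_min rho20 divr_gt0.
move=> y h ch h0 tr u uM; rewrite leNgt; apply/negP => hu.
have [||c cu hc] := @IVT_between R (fun v => `|h v - v|) 0 u eta.
- move=> v; apply: cvg_norm; apply: cvgB; [exact: ch|exact: cvg_id].
- by rewrite h0 subrr normr0 eta0 ltW.
rewrite !subr0 in cu.
have hcM : `|h c| <= M + eta.
  by rewrite -(subrK c (h c)) (le_trans (ler_normD _ _))// hc; lra.
have t1 := flow_sep_norm x sep hc.
have := tr c; rewrite le_min => /andP[t2 _].
have := tr 0; rewrite h0 !flow0 le_min => /andP[_ t3].
have t4 : mdist (phi (h c) x) (phi (h c) y) < rho / 2.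
  apply: dK; last by rewrite /K /= in_itv /= -ler_norml.
  by rewrite ballEmdist /=; lra.
have := metric_triangle (phi (h c) x) (phi (h c) y) (phi c x).
rewrite (metric_sym (phi (h c) y)); lra.
Qed.

Lemma self_tracking_near_id (eta rho : R) (x : X) (g : R -> R) (s : R) :
  (forall z, rho < mdist z (phi eta z)) -> continuous g ->
  (forall t, mdist (phi t x) (phi (g t) x) <= rho) ->
  `|g s - s| <= eta -> forall t, `|g t - t| <= eta.
Proof.
move=> sep cg tr gs t; rewrite leNgt; apply/negP => gt.
have [||c _ gc] := @IVT_between R (fun v => `|g v - v|) s t eta.
- move=> v; apply: cvg_norm; apply: cvgB; [exact: cg|exact: cvg_id].
- by rewrite gs ltW.
have := flow_sep_norm x sep gc.
by rewrite metric_sym ltNge tr.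
Qed.

Lemma flow_uniform_sep : compact [set: X] -> regular_flow phi ->
  exists2 tau, 0 < tau & forall eta, 0 < eta <= tau ->
    exists2 rho, 0 < rho & forall z, rho < mdist z (phi eta z).
Proof.
move=> cX reg; have [tau tau0 H] := flow_no_short_period cX reg.
exists tau => // eta etat.
have [|z _|rho rho0 Hr] := @compact_pos_lbound R X setT
  (fun z => mdist z (phi eta z)) cX.
- move=> z; apply: mdist_cvg; first exact: cvg_id.
  by apply: flow_cvg; [exact: cvg_cst|exact: cvg_id].
- by rewrite mdist_gt0; apply/eqP => /esym; apply: H.
by exists rho => // z; apply: Hr.
Qed.

(** * Close trackers of x lie on its orbit *)

Lemma expansive_orbit_tracking x : expansive_on phi (~` orb phi x) ->
  exists2 delta, 0 < delta & forall y h, Rep h ->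
    (forall t, mdist (phi t x) (phi (h t) y) <= delta) -> orb phi x y.
Proof.
move=> ex; have [d d0 Hd] := ex 1 ltr01.
have d20 : 0 < d / 2 by rewrite divr_gt0.
apply: contrapT => no.
have bad e : 0 < e -> exists y h, [/\ Rep h,
    forall t, mdist (phi t x) (phi (h t) y) <= e & ~ orb phi x y].
  move=> e0; apply: contrapT => nob; apply: no; exists e => // y h Rh tr.
  by apply: contrapT => xy; apply: nob; exists y, h.
have [y [h [Rh tr xy]]] := bad _ d20.
have nr r : x <> phi r y.
  by move=> xr; apply: xy; exists (- r) => //; rewrite xr -flowD subrr flow0.
(* The distance from x to phi_[-1,1] y exceeds e > 0, x being off the orbit of y. A second tracker
   y' within e of x then has to miss this segment, while expansivity, applied to y and y' compared
   through x, puts it there. *)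
have [|r rI|e e0 He] := @compact_pos_lbound R R `[-1, 1]%classic
    (fun r => mdist x (phi r y)) (@segment_compact R (-1) 1).
- move=> r; apply: mdist_cvg; first exact: cvg_cst.
  by apply: flow_cvg; [exact: cvg_id|exact: cvg_cst].
- by rewrite mdist_gt0; apply/eqP.
have [|y' [h' [Rh' tr' xy']]] := bad (Num.min (d / 2) e).
  by rewrite lt_min d20.
have [k [Rk hk]] := Rep_inv Rh.
have [|r r1 yr] := Hd y y' (h' \o k) xy xy' (Rep_comp Rk Rh').
  move=> t; have := tr (k t); have := tr' (k t); rewrite hk le_min /=.
  move=> /andP[+ _]; have := metric_triangle (phi t y) (phi (k t) x) (phi (h' (k t)) y').
  rewrite (metric_sym (phi t y) (phi (k t) x)); lra.
have := He r; rewrite /= in_itv /= -ler_norml => /(_ r1).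
have := tr' 0; have [_ [_ [_ ->]]] := Rh'.
by rewrite !flow0 le_min -yr ltNge => /andP[_ ->].
Qed.

(** Both times reduce modulo T to the compact square [0,T]^2. Near a pair of times with the same
    point, r is the difference of the two time increments; near any other pair the distance is
    bounded below, so the hypothesis fails for small delta. *)
Lemma periodic_orbit_near x T e : 0 < T -> phi T x = x -> 0 < e ->
  exists2 delta, 0 < delta & forall s t,
    mdist (phi s x) (phi t x) <= delta ->
    exists2 r, `|r| <= e & phi t x = phi (s + r) x.
Proof.
move=> T0 Tx e0; have e20 : 0 < e / 2 by rewrite divr_gt0.
pose P d (p : R * R) := mdist (phi p.1 x) (phi p.2 x) <= d ->
    exists2 r, `|r| <= e & phi p.2 x = phi (p.1 + r) x.
have cK : compact (`[0, T]%classic `*` `[0, T]%classic : set (R * R)%type).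
  by apply: compact_setX; exact: segment_compact.
have [p _|d d0 Hd] := @near_unif_compact R _ _ P cK.
  have [pp|pp] := eqVneq (phi p.1 x) (phi p.2 x).
    near=> q d => /= _; exists ((q.2 - p.2) - (q.1 - p.1)).
      have H1 : `|q.1 - p.1| <= e / 2.
        rewrite distrC; near: q.
        exact: (@cvgr_dist_le R R (R * R)%type (nbhs p) _ fst p.1 cvg_fst _ e20).
      have H2 : `|q.2 - p.2| <= e / 2.
        rewrite distrC; near: q.
        exact: (@cvgr_dist_le R R (R * R)%type (nbhs p) _ snd p.2 cvg_snd _ e20).
      by rewrite (le_trans (ler_normB _ _))// [leRHS]splitr lerD.
    have -> : q.1 + (q.2 - p.2 - (q.1 - p.1)) = p.1 + (q.2 - p.2) by ring.
    by rewrite flowD pp -flowD subrKC.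
  rewrite -mdist_gt0 in pp.
  have half : mdist (phi p.1 x) (phi p.2 x) / 2 < mdist (phi p.1 x) (phi p.2 x).
    by rewrite ltr_pdivrMr // ltr_pMr // ltr1n.
  near=> q d => /= qd; exfalso; move: qd; apply/negP; rewrite -ltNge.
  apply: (@lt_trans _ _ (mdist (phi p.1 x) (phi p.2 x) / 2)).
    by near: d; apply: nbhs_right_lt; rewrite divr_gt0.
  near: q; apply: (@cvgr_gt R (R * R)%type (nbhs p) _
    (fun q => mdist (phi q.1 x) (phi q.2 x)) _ _ _ half).
  apply: mdist_cvg; apply: flow_cvg; try exact: cvg_cst.
    exact: cvg_fst.
  exact: cvg_snd.
exists d => // s t.
have red u : exists2 v, `[0, T]%classic v & exists2 k : int, u = k%:~R * T + v
    & phi u x = phi v x.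
  exists (u - (Num.floor (u / T))%:~R * T).
    rewrite /= in_itv /= subr_ge0 -ler_pdivlMr // floor_le /=.
    rewrite lerBlDl; have := Num.Theory.floorD1_gt (u / T).
    by rewrite intrD ltr_pdivrMr // mulrDl mul1r => /ltW.
  exists (Num.floor (u / T)); first by rewrite subrKC.
  by rewrite -[in LHS](subrKC ((Num.floor (u / T))%:~R * T) u) flowD flow_periodZ.
have [s' s'K [k sk ->]] := red s; have [t' t'K [_ _ ->]] := red t.
move=> /(Hd (s', t') (conj s'K t'K)) [r re /= ->]; exists r => //.
by rewrite sk -addrA [in RHS]flowD flow_periodZ.
Unshelve. all: by end_near. Qed.

(** The bound confines [g s] to [-M, M], where by aperiodicity only q = s gives phi_q x = phi_s x.
    So fine trackings have [g s] near s, and [self_tracking_near_id] carries this to all times. *)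
Lemma self_tracking_bounded x e d M s : compact [set: X] -> regular_flow phi ->
  (forall t, phi t x = x -> t = 0) -> 0 < e -> 0 < d ->
  (forall g, increasing_homeo g ->
    (forall t, mdist (phi t x) (phi (g t) x) <= d) -> `|g s| <= M) ->
  exists2 delta, 0 < delta & forall g, increasing_homeo g ->
    (forall t, mdist (phi t x) (phi (g t) x) <= delta) ->
    forall t, `|g t - t| <= e.
Proof.
move=> cX reg np e0 d0 bnd.
have [tau tau0 sep] := flow_uniform_sep cX reg.
pose eta := Num.min e tau.
have eta0 : 0 < eta by rewrite lt_min e0.
have [|rho rho0 Hrho] := sep eta; first by rewrite eta0 ge_min lexx orbT.
pose P d q := mdist (phi s x) (phi q x) <= d -> `|q - s| <= eta.
have [q _|d1 d10 Hd1] := @near_unif_compact R _ _ P (@segment_compact R (- M) M).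
  have [->|qs] := eqVneq q s.
    near=> p d' => /= _; rewrite distrC; near: p.
    exact: (@cvgr_dist_le R R R (nbhs s) _ id s cvg_id).
  have pp : 0 < mdist (phi s x) (phi q x).
    rewrite mdist_gt0; apply/eqP => sq; move/eqP: qs; apply.
    by apply/eqP; rewrite -subr_eq0; apply/eqP/np; rewrite flowD -sq -flowD subrr.
  have half : mdist (phi s x) (phi q x) / 2 < mdist (phi s x) (phi q x).
    by rewrite ltr_pdivrMr // ltr_pMr // ltr1n.
  near=> p d' => /= pd; exfalso; move: pd; apply/negP; rewrite -ltNge.
  apply: (@lt_trans _ _ (mdist (phi s x) (phi q x) / 2)).
    by near: d'; apply: nbhs_right_lt; rewrite divr_gt0.
  near: p; apply: (@cvgr_gt R R (nbhs q) _
    (fun p => mdist (phi s x) (phi p x)) _ _ _ half).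
  apply: mdist_cvg; first exact: cvg_cst.
  by apply: flow_cvg; [exact: cvg_id|exact: cvg_cst].
exists (Num.min d (Num.min d1 rho)); first by rewrite !lt_min d0 d10.
move=> g hg tr t; have [_ cg _] := hg.
apply: (@le_trans _ _ eta); last by rewrite ge_min lexx.
have tr3 u : [/\ mdist (phi u x) (phi (g u) x) <= d,
    mdist (phi u x) (phi (g u) x) <= d1 & mdist (phi u x) (phi (g u) x) <= rho].
  by have := tr u; rewrite !le_min => /and3P.
apply: (self_tracking_near_id (x := x) (s := s) Hrho cg).
  by move=> u; have [] := tr3 u.
suff /Hd1 : `[- M, M]%classic (g s) by apply; have [] := tr3 s.
rewrite /= in_itv /= -ler_norml; apply: bnd => // u.
by have [] := tr3 u.
Unshelve. all: by end_near. Qed.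

(** * Infinite composition of escaping self-trackings *)

(** g' is [f \o g], with f a fine self-tracking sending [g 0] outside [-k, k]. Increments from time
    0 are compared, since [g' 0] need not be near [g 0]; the alternative on [|g t - g 0|] later
    makes the limit surjective. *)
Lemma escape_step x (k : nat) g e : compact [set: X] -> regular_flow phi ->
  (forall t, phi t x = x -> t = 0) -> self_tracking_escapes phi x ->
  increasing_homeo g -> 0 < e ->
  exists g' e', [/\ increasing_homeo g', 0 < e' <= e / 2,
    forall t, mdist (phi (g t) x) (phi (g' t) x) <= e / 2,
    forall t, (`|t| <= k%:R) || (`|g t - g 0| <= k%:R) ->
      `|(g' t - g' 0) - (g t - g 0)| <= e / 2 &
    forall s, `|s| <= k%:R -> e' < mdist (phi (g' 0) x) (phi s x)].
Proof.
move=> cX reg np esc [gm gc gs] e0.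
have e20 : 0 < e / 2 by rewrite divr_gt0.
have [tau tau0 sep] := flow_uniform_sep cX reg.
pose eta := Num.min (e / 2) tau.
have eta0 : 0 < eta by rewrite lt_min e20.
have [|rho rho0 Hrho] := sep eta; first by rewrite eta0 ge_min lexx orbT.
(* By monotonicity, M bounds [|g t - g 0|] under either alternative. *)
pose M := k%:R + `|g k%:R - g 0| + `|g (- k%:R) - g 0|.
have [d1 d10 Hd1] :=
  tracking_near_id M (phi (g 0) x) (ltW eta0) rho0 Hrho.
have [|f [[fm fc fs] ftr fk]] := esc (Num.min (e / 2) d1) k%:R (g 0).
  by rewrite lt_min e20.
have [s|s|e1 e10 He1] := @compact_pos_lbound R R `[- k%:R, k%:R]%classic
    (fun s => mdist (phi (f (g 0)) x) (phi s x)) (@segment_compact R _ _).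
- apply: mdist_cvg; first exact: cvg_cst.
  by apply: flow_cvg; [exact: cvg_id|exact: cvg_cst].
- rewrite /= in_itv /= -ler_norml => sk; rewrite mdist_gt0; apply/eqP => fsx.
  move: fk; rewrite ltNge => /negP; apply.
  suff -> : f (g 0) = s by [].
  by apply/eqP; rewrite -subr_eq0; apply/eqP/np; rewrite flowD fsx -flowD subrr.
exists (f \o g), (Num.min (e / 2) e1); split.
- split; first by move=> s t /gm /fm.
    by move=> t; apply: continuous_comp; [exact: gc|exact: fc].
  by move=> y; have [u <-] := fs y; have [t <-] := gs u; exists t.
- by rewrite lt_min e20 e10 ge_min lexx.
- by move=> t; have := ftr (g t); rewrite le_min => /andP[].
- move=> t tk.
  have tM : `|g t - g 0| <= M.
    have n1 := normr_ge0 (g k%:R - g 0); have n2 := normr_ge0 (g (- k%:R) - g 0).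
    move: tk => /orP[|]; last by rewrite /M; lra.
    rewrite ler_norml => /andP[]; move=> /(ltW_homo gm) t1 /(ltW_homo gm) t2.
    have k0 : 0 <= k%:R :> R by [].
    have := ler_norm (g k%:R - g 0).
    have := ler_norm (- (g (- k%:R) - g 0)); rewrite normrN => u1 u2.
    by rewrite ler_norml /M; lra.
  (* Seen from phi_(g 0) x, f becomes a time change fixing 0, towards the point phi_(f (g 0)) x. *)
  have := Hd1 (phi (f (g 0)) x) (fun u => f (g 0 + u) - f (g 0)) _ _ _ _ tM.
  rewrite subrKC le_min => H; have [||u|-> //] := andP (H _ _ _).
  + move=> u; apply: cvgB; last exact: cvg_cst.
    apply: (@continuous_comp _ _ _ (fun u => g 0 + u) f); last exact: fc.
    by apply: cvgD; [exact: cvg_cst|exact: cvg_id].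
  + by rewrite addr0 subrr.
  + rewrite -!flowD subrKC; apply: le_trans (ftr _) _.
    by rewrite ge_min lexx orbT.
- move=> s sk; rewrite gt_min He1 ?orbT //.
  by rewrite /= in_itv /= -ler_norml.
Qed.

Lemma escape_tracking x d : compact [set: X] -> regular_flow phi ->
  (forall t, phi t x = x -> t = 0) -> self_tracking_escapes phi x -> 0 < d ->
  exists y h, [/\ Rep h, forall t, mdist (phi t x) (phi (h t) y) <= d &
    ~ orb phi x y].
Proof.
move=> cX reg np esc d0.
have d20 : 0 < d / 2 by rewrite divr_gt0.
have /choice[F HF] : forall p : nat * ((R -> R) * R), exists q : (R -> R) * R,
    increasing_homeo p.2.1 -> 0 < p.2.2 ->
    [/\ increasing_homeo q.1, 0 < q.2 <= p.2.2 / 2,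
    forall t, mdist (phi (p.2.1 t) x) (phi (q.1 t) x) <= p.2.2 / 2,
    forall t, (`|t| <= p.1%:R) || (`|p.2.1 t - p.2.1 0| <= p.1%:R) ->
      `|(q.1 t - q.1 0) - (p.2.1 t - p.2.1 0)| <= p.2.2 / 2 &
    forall s, `|s| <= p.1%:R -> q.2 < mdist (phi (q.1 0) x) (phi s x)].
  move=> [k [g e]] /=.
  have [[hg e0]|no] := pselect (increasing_homeo g /\ 0 < e).
    have [g' [e' H]] := @escape_step x k g e cX reg np esc hg e0.
    by exists (g', e').
  by exists (g, e) => hg e0; exfalso; apply: no.
(* The sequence g_n with a precision budget e_n: everything done after stage n
   costs at most e_n in total, and e_(n+1) is below the distance from the new
   point to phi_[-n,n] x. *)
pose S n := iteri n (fun k p => F (k, p)) (id, Num.min (d / 2) 1).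
pose g n := (S n).1; pose e n := (S n).2.
have e_0 : e 0%N = Num.min (d / 2) 1 by [].
have g_0 : g 0%N = id by [].
have inv n : increasing_homeo (g n) /\ 0 < e n.
  elim: n => [|n [hg e0]].
    split; last by rewrite e_0 lt_min d20 ltr01.
    split => // [t|y]; first exact: cvg_id.
    by exists y.
  by have [? /andP[? _] _ _ _] := HF (n, S n) hg e0.
have hg n : increasing_homeo (g n) by have [] := inv n.
have e0 n : 0 < e n by have [] := inv n.
have step n := HF (n, S n) (hg n) (e0 n).
have e2 n : e n.+1 <= e n / 2 by have [_ /andP[]] := step n.
(* The cost e_n / 2 of a step is at most e_n - e_(n+1), so costs telescope. *)
have g2 n t : mdist (phi (g n t) x) (phi (g n.+1 t) x) <= e n - e n.+1.
  by have [_ _ H _ _] := step n; have := H t; have := e2 n;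
    rewrite -/(g n) -/(g n.+1) -/(e n); lra.
pose h n t := g n t - g n 0.
have h2 n t : (`|t| <= n%:R) || (`|h n t| <= n%:R) ->
    `|h n.+1 t - h n t| <= e n - e n.+1.
  have [_ _ _ H _] := step n => tn; have := H t tn; have := e2 n;
    rewrite -/(g n) -/(g n.+1) -/(e n) -/(h n t) -/(h n.+1 t); lra.
have far n s : `|s| <= n%:R -> e n.+1 < mdist (phi (g n.+1 0) x) (phi s x).
  by have [_ _ _ _ H] := step n; exact: H.
clearbody g e; clear S HF inv step F.
have edec n k : (n <= k)%N -> e k <= e n.
  elim: k => [|k IH]; first by rewrite leqn0 => /eqP ->.
  rewrite leq_eqVlt => /orP[/eqP -> //|/IH]; have := e2 k; have := e0 k; lra.
(* Enough for e_n to tend to 0; the induction uses (n+2)/2 <= n+1. At n = 0 it reads e_0 <= 1. *)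
have e1 n : e n * n.+1%:R <= 1.
  elim: n => [|n IH]; first by rewrite mulr1 e_0 ge_min lexx orbT.
  have : e n.+1 * n.+2%:R <= e n / 2 * n.+2%:R by rewrite ler_pM2r.
  move/le_trans; apply; apply: le_trans IH; rewrite -mulrA ler_pM2l //.
  have : 0 <= n%:R :> R by [].
  rewrite -[n.+2]addn2 -[n.+1]addn1 !natrD; lra.
have ecvg b : 0 < b -> \forall n \near \oo, e n <= b.
  move=> b0; near=> n.
  have bn : b^-1 <= n%:R by near: n; exact: nbhs_infty_ger.
  have := e1 n; rewrite -ler_pdivlMr // => /le_trans; apply.
  rewrite div1r -[leRHS]invrK lef_pV2 ?posrE ?invr_gt0 //.
  by rewrite (le_trans bn) // ler_nat.
have htel n t : `|t| <= n%:R -> forall k, (n <= k)%N ->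
    `|h k t - h n t| <= e n - e k.
  move=> tn k; elim: k => [|k IH];
    first by rewrite leqn0 => /eqP ->; rewrite !subrr normr0.
  rewrite leq_eqVlt => /orP[/eqP <-|nk]; first by rewrite !subrr normr0.
  have := IH nk; have := h2 k t; rewrite (le_trans tn) ?ler_nat //= => /(_ isT).
  have := ler_distD (h k t) (h k.+1 t) (h n t); lra.
(* Control by value instead of time: the total drift is at most e_0 <= 1, so the margin 1 keeps
   [|h k t| <= k] at all later stages. *)
have htel' n t : `|h n t| + 1 <= n%:R -> forall k, (n <= k)%N ->
    `|h k t - h n t| <= e n - e k.
  move=> tn k; elim: k => [|k IH];
    first by rewrite leqn0 => /eqP ->; rewrite !subrr normr0.
  rewrite leq_eqVlt => /orP[/eqP <-|nk]; first by rewrite !subrr normr0.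
  have IHk := IH nk; have := h2 k t; have -> : `|h k t| <= k%:R.
    have : n%:R <= k%:R :> R by rewrite ler_nat.
    have := edec _ _ (leq0n n); have := e0 k; have := e1 0%N; rewrite mulr1.
    have := ler_distD (h n t) (h k t) 0; rewrite !subr0; lra.
  rewrite orbT => /(_ isT).
  have := ler_distD (h k t) (h k.+1 t) (h n t); lra.
have wtel t n k : (n <= k)%N -> mdist (phi (g n t) x) (phi (g k t) x) <= e n - e k.
  elim: k => [|k IH]; first by rewrite leqn0 => /eqP ->; rewrite mdistxx subrr.
  rewrite leq_eqVlt => /orP[/eqP <-|nk]; first by rewrite mdistxx subrr.
  have := IH nk; have := g2 k t.
  have := metric_triangle (phi (g n t) x) (phi (g k t) x) (phi (g k.+1 t) x); lra.
(* A cluster point by compactness; [wtel] upgrades it to a limit at rate e_n. *)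
have [w Hw] : exists w, forall n, mdist (phi (g n 0) x) w <= e n.
  have [w [_ cw]] := cX ((fun n => phi (g n 0) x) @ \oo) _ filterT.
  exists w => n; apply/ler_addgt0Pr => b b0.
  have [|_ [[k nk <-]]] :=
      cw [set phi (g k 0) x | k in [set k | (n <= k)%N]] _ _ (nbhsx_ballx w b b0).
    by exists n => // k nk; exists k.
  rewrite ballEmdist /= metric_sym => kw.
  have := wtel 0 _ _ nk; have := e0 k.
  have := metric_triangle (phi (g n 0) x) (phi (g k 0) x) w; lra.
(* L t is the limit of [h n t], obtained as the supremum of the lower bounds h_n t - e_n over n >=
   |t|. *)
have /choice[L HL] : forall t, exists l, forall n, `|t| <= n%:R -> `|h n t - l| <= e n.
  move=> t; pose E := [set h n t - e n | n in [set n : nat | `|t| <= n%:R]].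
  have key n k : `|t| <= n%:R -> `|t| <= k%:R -> h n t - e n <= h k t + e k.
    move=> tn tk; case/orP: (leq_total n k) => nk.
      by have := htel _ _ tn _ nk; have := e0 k; rewrite ler_norml; lra.
    by have := htel _ _ tk _ nk; have := e0 n; rewrite ler_norml; lra.
  exists (sup E) => n tn; rewrite ler_distlC; apply/andP; split.
    by apply: ub_le_sup; [exists (h n t + e n) => _ [k tk <-]; exact: key|exists n].
  by apply: ge_sup; [exists (h n t - e n); exists n|move=> _ [k tk <-]; exact: key].
have bnd (t : R) : \forall n \near \oo, `|t| <= n%:R by exact: nbhs_infty_ger.
have L0 : L 0 = 0.
  apply/eqP; rewrite -normr_le0; apply/ler_addgt0Pr => b b0; rewrite add0r.
  near \oo => n; apply: (@le_trans _ _ (e n)); last by near: n; exact: ecvg.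
  by have := HL 0 n; rewrite /h subrr sub0r normrN normr0; apply.
have Lm s t : s < t -> L s <= L t.
  move=> st; apply/ler_addgt0Pr => b b0.
  near \oo => n.
  have sn : `|s| <= n%:R by near: n; exact: bnd.
  have tn : `|t| <= n%:R by near: n; exact: bnd.
  have en : e n <= b / 2 by near: n; apply: ecvg; rewrite divr_gt0.
  have [gm _ _] := hg n; have := gm _ _ st.
  have := HL _ _ sn; have := HL _ _ tn; rewrite !ler_norml /h; lra.
have Lc : continuous L.
  move=> t; apply/cvgrPdist_le => b b0; have b30 : 0 < b / 3 by rewrite divr_gt0.
  near \oo => n.
  have tn : `|t| + 1 <= n%:R by near: n; exact: nbhs_infty_ger.
  have en : e n <= b / 3 by near: n; apply: ecvg.
  have [_ gc _] := hg n.
  near=> s.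
  have ts : `|t - s| <= 1.
    by near: s; exact: (@cvgr_dist_le R R R (nbhs t) _ id t cvg_id _ ltr01).
  have gs : `|g n t - g n s| <= b / 3.
    near: s; exact: (@cvgr_dist_le R R R (nbhs t) _ (g n) (g n t) (gc t) _ b30).
  have tn' : `|t| <= n%:R by lra.
  have sn : `|s| <= n%:R.
    by have := ler_distD t s 0; rewrite !subr0 (distrC s); lra.
  have := HL _ _ tn'; have := HL _ _ sn; move: gs; rewrite !ler_norml /h; lra.
(* Coarse surjectivity suffices, as the intermediate value theorem will fill the gaps. A preimage of
   v under [h n] works, because [htel'] keeps its later images near v. *)
have Lsurj v : exists t, `|L t - v| <= 2.
  near \oo => n.
  have vn : `|v| + 1 <= n%:R by near: n; exact: nbhs_infty_ger.
  have [_ _ gs] := hg n; have [t gt] := gs (v + g n 0); exists t.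
  have hv : h n t = v by rewrite /h gt addrK.
  near \oo => k.
  have tk : `|t| <= k%:R by near: k; exact: bnd.
  have nk : (n <= k)%N by near: k; exact: nbhs_infty_ge.
  have := htel' n t; rewrite hv => /(_ vn _ nk); have := HL _ _ tk.
  have := edec _ _ (leq0n n); have := edec _ _ (leq0n k); have := e0 k.
  have := e1 0%N; rewrite mulr1 !ler_norml; lra.
have Ltr t : mdist (phi t x) (phi (L t) w) <= d / 2.
  rewrite leNgt; apply/negP => tw.
  have wcvg : phi (g n 0) x @[n --> \oo] --> w.
    apply/metricType_numDomainType.cvgrPdist_le => b b0; near=> n.
    rewrite metric_sym (le_trans (Hw n)) //.
    by near: n; exact: ecvg.
  have hcvg : h n t @[n --> \oo] --> L t.
    apply/cvgrPdist_le => b b0; near=> n.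
    rewrite distrC; apply: (@le_trans _ _ (e n)).
      by apply: HL; near: n; exact: bnd.
    by near: n; exact: ecvg.
  (* The second point is phi_(g_n t) x, which is within e_0 <= d / 2 of phi_t x at every stage. *)
  have : \forall n \near \oo, d / 2 < mdist (phi t x) (phi (h n t) (phi (g n 0) x)).
    apply: (@cvgr_gt R nat \oo _
      (fun n => mdist (phi t x) (phi (h n t) (phi (g n 0) x))) _ _ _ tw).
    by apply: mdist_cvg; [exact: cvg_cst|exact: flow_cvg].
  case=> N _ /(_ _ (leqnn N)) /=; rewrite -flowD /h subrKC.
  have := wtel t _ _ (leq0n N); rewrite g_0 /=.
  have : e 0%N <= d / 2 by rewrite e_0 ge_min lexx.
  by have := e0 N; lra.
have [th th0 Hth] := flow_small_time cX d20.
(* L is only nondecreasing; a small bounded increasing perturbation puts it in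
   Rep and moves points of the flow by at most d / 2. *)
pose a t := th / pi * atan t.
have ac : 0 < th / pi :> R by rewrite divr_gt0 // pi_gt0.
have ath t : `|a t| <= th.
  have := atan_ltpi2 t; have := atan_gtNpi2 t; have := pi_gt0 R => p0 a1 a2.
  rewrite /a normrM (gtr0_norm ac) mulrAC ler_pdivrMr // ler_pM2l //.
  rewrite ler_norml; lra.
have am s t : s < t -> a s < a t by move=> st; rewrite ltr_pM2l // lt_atan.
have acont : continuous (fun t => L t + a t).
  move=> t; apply: cvgD; first exact: Lc.
  by apply: cvgM; [exact: cvg_cst|exact: continuous_atan].
exists w, (fun t => L t + a t); split.
- split; first by move=> s t st; have := Lm _ _ st; have := am _ _ st; lra.
  split => //; split; last by rewrite L0 /a atan0 mulr0 addr0.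
  (* The margin th + 2 absorbs [|a| <= th] and the error 2 of [Lsurj]. *)
  move=> y; have [t1 H1] := Lsurj (y - th - 2); have [t2 H2] := Lsurj (y + th + 2).
  have [|c _ cy] := @IVT_between R _ t1 t2 y acont; last by exists c.
  move: (ath t1) (ath t2) H1 H2; rewrite !ler_norml; lra.
- move=> t; rewrite flowD.
  have := Hth _ (phi (L t) w) (ath t); have := Ltr t.
  rewrite (metric_sym (phi (a t) _)).
  have := metric_triangle (phi t x) (phi (L t) w) (phi (a t) (phi (L t) w)); lra.
(* w is within e_(n+1) of phi_(g_(n+1) 0) x, but phi_s x is farther than that once [|s| <= n]. *)
- move=> [s _ sw]; near \oo => n.
  have sn : `|s| <= n%:R by near: n; exact: bnd.
  by have := far _ _ sn; rewrite sw ltNge Hw.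
Unshelve. all: by end_near. Qed.

(** The conclusion concerns points, not [g s - s], because on a periodic orbit g may be shifted by a
    period. In the aperiodic case, failure for e yields [self_tracking_escapes] through
    [self_tracking_bounded], and [escape_tracking] then contradicts the hypothesis on trackers. *)
Lemma self_tracking_orbit x d : compact [set: X] -> regular_flow phi ->
  0 < d ->
  (forall y h, Rep h -> (forall t, mdist (phi t x) (phi (h t) y) <= d) ->
    orb phi x y) ->
  forall e, 0 < e -> exists2 delta, 0 < delta & forall g, increasing_homeo g ->
    (forall t, mdist (phi t x) (phi (g t) x) <= delta) ->
    forall s, exists2 r, `|r| <= e & phi (g s) x = phi (s + r) x.
Proof.
move=> cX reg d0 Hd e e0.
have [[T [T0 Tx]]|per] := pselect (exists T, 0 < T /\ phi T x = x).
  have [delta delta0 H] := periodic_orbit_near T0 Tx e0.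
  by exists delta => // g _ tr s; apply: H.
have np t : phi t x = x -> t = 0.
  move=> tx; case: (ltgtP t 0) => // t0; exfalso; apply: per.
    exists (- t); rewrite oppr_gt0; split => //.
    by rewrite -[in LHS]tx -flowD subrr flow0.
  by exists t.
apply: contrapT => no.
have [|y [h [Rh tr xy]]] := @escape_tracking x d cX reg np _ d0.
  move=> d' M s d'0; apply: contrapT => nog; apply: no.
  have [|delta delta0 H] := self_tracking_bounded (M := M) (s := s) cX reg np e0 d'0.
    move=> g hg tr; rewrite leNgt; apply/negP => Mg.
    by apply: nog; exists g.
  exists delta => // g hg tr t; exists (g t - t); first exact: H.
  by rewrite subrKC.
by apply: xy; exact: (Hd y h).
Qed.

End flow.

Theorem theoremC (R : realType) (X : metricType R) (phi : R -> X -> X) (x1 : X) :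
  compact [set: X] -> is_flow phi -> regular_flow phi ->
  expansive_on phi (~` orb phi x1) ->
  expansive_on phi [set: X].
Proof.
move=> cX flow reg ex eps eps0.
have [_ [flow0 flowD]] := flow.
have [d1 d10 H1] := ex _ eps0.
have [d2 d20 H2] := expansive_orbit_tracking flow ex.
have [d3 d30 H3] := self_tracking_orbit flow cX reg d20 H2 eps0.
exists (Num.min d1 (Num.min d2 d3)); first by rewrite !lt_min d10 d20.
have orbx x y h : orb phi x1 x -> Rep h ->
    (forall t, mdist (phi t x) (phi (h t) y) <= Num.min d2 d3) ->
    exists2 s, `|s| <= eps & y = phi s x.
  move=> [s _ <-] [hm [hc [hs h0]]] tr.
  (* Rebase at x1: x = phi_s x1, so time -s for x is time 0 for x1, and the tracker is then at phi_c
     y. *)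
  pose c := h (- s).
  have tr' t : mdist (phi t x1) (phi (h (t - s) - c) (phi c y)) <= Num.min d2 d3.
    by have := tr (t - s); rewrite -!flowD !subrKC.
  have hsc : continuous (fun t => h (t - s)).
    move=> t; apply: (@continuous_comp _ _ _ (fun t => t - s) h); last exact: hc.
    by apply: cvgB; [exact: cvg_id|exact: cvg_cst].
  have hsm : {homo (fun t => h (t - s)) : u v / u < v}.
    by move=> u v uv; apply: hm; rewrite ltrD2r.
  have hss v : exists t, h (t - s) = v.
    by have [u <-] := hs v; exists (u + s); rewrite addrK.
  have [q _ qy] : orb phi x1 (phi c y).
    apply: (H2 _ (fun t => h (t - s) - c)); last first.
      by move=> t; have := tr' t; rewrite le_min => /andP[].
    split; first by move=> u v uv; rewrite ltrD2r; exact: hsm.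
    split; first by move=> t; apply: cvgB; [exact: hsc|exact: cvg_cst].
    split; last by rewrite sub0r subrr.
    by move=> v; have [t tv] := hss (v + c); exists t; rewrite tv addrK.
  (* With phi_c y = phi_q x1, the orbit of x1 tracks itself. At time s this map takes the value q -
     c, and phi_(q - c) x1 = y. *)
  have [||r re] := H3 (fun t => h (t - s) - c + q) _ _ s.
  - split; first by move=> u v uv; rewrite !ltrD2r; exact: hsm.
      move=> t; apply: cvgD; last exact: cvg_cst.
      by apply: cvgB; [exact: hsc|exact: cvg_cst].
    by move=> v; have [t tv] := hss (v - q + c); exists t; rewrite tv addrK subrK.
  - by move=> t; have := tr' t; rewrite -qy -flowD addrC le_min => /andP[].
  rewrite subrr h0 sub0r => cq; exists r => //.
  have -> : y = phi (- c + q) x1.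
    by rewrite addrC flowD qy -flowD subrr flow0.
  by rewrite cq flowD.
move=> x y h _ _ Rh tr.
have tr1 t : mdist (phi t x) (phi (h t) y) <= d1.
  by have := tr t; rewrite le_min => /andP[].
have tr2 t : mdist (phi t x) (phi (h t) y) <= Num.min d2 d3.
  by have := tr t; rewrite le_min => /andP[].
have [xo|xo] := pselect (orb phi x1 x); first exact: orbx tr2.
have [yo|yo] := pselect (orb phi x1 y); last exact: H1 tr1.
(* Only y is on the orbit: exchange the roles of x and y by inverting h. *)
have [k [Rk hk]] := Rep_inv Rh.
have [|s se xy] := orbx y x k yo Rk.
  by move=> t; rewrite metric_sym -{2}(hk t).
by exists (- s); rewrite ?normrN // xy -flowD subrr flow0.
Qed.
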